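(* Let $\alpha\ne0$, $\lambda\in\mathbb{R}$. Let $g_0\in\mathcal{M}$ be Einstein, $\rho(g_0)=\tfrac{\tau_0}{n}g_0$ with $\tau_0=\tau(g_0)$ constant, and consider $g_t=c(t)\,g_0$ with $c(t)>0$ a smooth function of $t\in I$. Then: (a) the momentum constraint $\delta^{-}_{g_t}g'_t=0$ holds automatically; (b) the evolution equation $g''=\Gamma^-_g(g',g')-2\alpha\operatorname{grad}^-S_\lambda(g)$ reduces to the scalar second order equation $$c''=\frac{4-n}{4}\,\frac{(c')^{2}}{c}+\frac{\alpha(n-2)\,\tau_0}{n(n-1)}-\alpha\lambda\,c;$$ (c) the Hamiltonian constraint $\mathcal{H}_\lambda(g_t,g'_t)=0$ reduces to the first order relation $$(c')^{2}=A\,c-B\,c^{2},\quad\text{where } A:=\frac{4\alpha\,\tau_0}{n(n-1)}\ \text{ and }\ B:=\frac{4\alpha\lambda}{n};$$ (d) on the constraint set $(c')^2=Ac-Bc^2$, the scalar evolution equation in (b) is equivalent to the linear equation $$c''=\tfrac12 A-B\,c.$$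
   Context: $M$ is a compact connected smooth manifold without boundary, $\dim M=n\ge2$; $I$ is an open interval. $S^2(M)$ is the space of smooth symmetric $(0,2)$-tensor fields on $M$, and $\mathcal{M}\subset S^2(M)$ is the open cone of Riemannian metrics. For $g\in\mathcal{M}$: $\rho(g)$ is the Ricci tensor, $\tau(g)=\operatorname{tr}_g\rho(g)$ the scalar curvature, $\mu_g$ the volume density, $\operatorname{tr}_gh=\operatorname{tr}(g^{-1}h)$, $(\delta_gh)_j=-g^{ik}\nabla_ih_{kj}$, and $$\langle h,k\rangle^-_g=\operatorname{tr}(g^{-1}hg^{-1}k)-\operatorname{tr}_g(h)\operatorname{tr}_g(k),\qquad G^-_g(h,k)=\int_M\langle h,k\rangle^-_g\,\mu_g,\qquad \delta^-_gh=\delta_gh+d(\operatorname{tr}_gh).$$ $\Gamma^-_g(h,h)=hg^{-1}h-\tfrac12\operatorname{tr}_g(h)h-\tfrac{1}{4(n-1)}\langle h,h\rangle^-_g\,g$ is the Christoffel map of $G^-$. Further, $\tau_\lambda(g)=\tau(g)-\lambda(n-1)$, $S_\lambda(g)=\int_M\tau_\lambda(g)\mu_g$, with $G^-$-gradient $\operatorname{grad}^-S_\lambda(g)=-\rho(g)+\frac{1}{2(n-1)}\tau(g)g+\frac{\lambda}{2}g$, and $\mathcal{H}_\lambda(g,k)=\tfrac12\langle k,k\rangle^-_g+2\alpha\tau_\lambda(g)\in C^\infty(M)$. *)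

(* Defs.v *)
(* Tensor fields are handled classically, through their components in charts:
   a field assigns to every chart [i] and every point [p] the components of the
   tensor at [p] in the coordinates of [i]; only values at points of the domain
   of [i] are meaningful. *)
From HB Require Import structures.
From mathcomp Require Import all_boot all_order all_algebra.
From mathcomp Require Import all_classical all_reals all_analysis.

Set Implicit Arguments.
Unset Strict Implicit.
Unset Printing Implicit Defensive.

Import Order.TTheory GRing.Theory Num.Theory.
Import numFieldNormedType.Exports.

Local Open Scope ring_scope.
Local Open Scope classical_set_scope.

(* [U] is meant to be open. *)
Fixpoint Ck_on (R : realType) (n k : nat) (U : set 'rV[R]_n)
    (f : 'rV[R]_n -> R) : Prop :=
  (forall x, U x -> {for x, continuous f}) /\
  (if k is k'.+1 then
     forall a : 'I_n,
       (forall x, U x -> derivable f x (delta_mx 0 a)) /\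
       Ck_on k' U ('D_(delta_mx 0 a) f)
   else True).

Definition smooth_on (R : realType) (n : nat) (U : set 'rV[R]_n)
    (f : 'rV[R]_n -> R) : Prop :=
  forall k, Ck_on k U f.

Definition smooth1_on (R : realType) (I : set R) (c : R -> R) : Prop :=
  forall (k : nat) t, I t -> derivable c^`(k) t 1.

(* Smooth n-manifold without boundary, given by a (not necessarily maximal)
   smooth atlas; [coord i] and [param i] are mutually inverse homeomorphisms
   between [dom i] and an open subset of R^n. *)
Record smoothManifold (R : realType) (n : nat) := SmoothManifold {
  carrier :> topologicalType;
  manifold_hausdorff : hausdorff_space carrier;
  manifold_second_countable : @second_countable carrier;
  chart : Type;
  dom : chart -> set carrier;
  coord : chart -> carrier -> 'rV[R]_n;
  param : chart -> 'rV[R]_n -> carrier;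
  dom_open : forall i, open (dom i);
  codom_open : forall i, open (coord i @` dom i);
  dom_cover : forall p : carrier, exists i, dom i p;
  coordK : forall i p, dom i p -> param i (coord i p) = p;
  coord_continuous : forall i p, dom i p -> {for p, continuous (coord i)};
  param_continuous : forall i x, (coord i @` dom i) x ->
    {for x, continuous (param i)};
  transition_smooth : forall i j (a : 'I_n),
    smooth_on (coord i @` (dom i `&` dom j))
              (fun x => coord j (param i x) 0 a)
}.

Section Fields.
Context {R : realType} {n : nat} {M : smoothManifold R n}.
Implicit Types (i : chart M) (p : M).

(* Scalar functions such as traces are independent of the chart in which they
   are computed; they are made into functions on [M] by this choice of charts. *)
Definition chart_at p : chart M := sval (cid (dom_cover p)).

Lemma chart_atP p : dom (chart_at p) p.
Proof. exact: svalP (cid (dom_cover p)). Qed.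

(* Coordinate derivative in the chart [i], viewed as a function on [M]. *)
Definition pd i (a : 'I_n) (f : M -> R) (p : M) : R :=
  'D_(delta_mx 0 a) (f \o param i) (coord i p).

Definition covector_field := chart M -> M -> 'rV[R]_n.

Definition tensor_field := chart M -> M -> 'M[R]_n.

Definition eq_field (T : Type) (h k : chart M -> M -> T) : Prop :=
  forall i p, dom i p -> h i p = k i p.

Definition scale_field (f : M -> R) (h : tensor_field) : tensor_field :=
  fun i p => f p *: h i p.

(* Row [a], column [b]: d y^b / d x^a, with x and y the coordinates of [i]
   and [j]. *)
Definition jacobian_chart i j (p : M) : 'M[R]_n :=
  \matrix_(a, b) pd i a (fun q => coord j q 0 b) p.

(* Smooth symmetric (0,2)-tensor fields: S^2(M). *)
Record sym_tensor (h : tensor_field) : Prop := SymTensor {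
  sym_tensor_sym : forall i p, dom i p -> (h i p)^T = h i p;
  sym_tensor_change : forall i j p, dom i p -> dom j p ->
    h i p = jacobian_chart i j p *m h j p *m (jacobian_chart i j p)^T;
  sym_tensor_smooth : forall i a b,
    smooth_on (coord i @` dom i) (fun x => h i (param i x) a b)
}.

Record riemannian_metric (g : tensor_field) : Prop := RiemannianMetric {
  metric_sym_tensor : sym_tensor g;
  metric_posdef : forall i p, dom i p -> forall v : 'rV[R]_n, v != 0 ->
    0 < (v *m g i p *m v^T) 0 0
}.

Section Geometry.
Variable g : tensor_field.

(* Gamma^k_{ab} of the Levi-Civita connection. *)
Definition christoffel i (k a b : 'I_n) (p : M) : R :=
  2^-1 * \sum_l (invmx (g i p) k l *
    (pd i a (fun q => g i q l b) p + pd i b (fun q => g i q l a) p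
     - pd i l (fun q => g i q a b) p)).

(* R(d_a, d_b) d_k = sum_l (riemann i l a b k) d_l, with
   R(X, Y) = [nabla_X, nabla_Y] - nabla_[X, Y]. *)
Definition riemann i (l a b k : 'I_n) (p : M) : R :=
  pd i a (christoffel i l b k) p - pd i b (christoffel i l a k) p
  + \sum_m (christoffel i l a m p * christoffel i m b k p
            - christoffel i l b m p * christoffel i m a k p).

(* Ric(Y, Z) = trace of X |-> R(X, Y) Z. *)
Definition ricci : tensor_field := fun i p =>
  \matrix_(b, k) \sum_a riemann i a a b k p.

Definition trg (h : tensor_field) (p : M) : R :=
  \tr (invmx (g (chart_at p) p) *m h (chart_at p) p).

Definition scalar_curvature : M -> R := trg ricci.

(* (nabla_a h)_{kb} *)
Definition nabla (h : tensor_field) i (a k b : 'I_n) (p : M) : R :=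
  pd i a (fun q => h i q k b) p
  - \sum_l (christoffel i l a k p * h i p l b)
  - \sum_l (christoffel i l a b p * h i p k l).

Definition delta (h : tensor_field) : covector_field := fun i p =>
  \row_j (- \sum_a \sum_k (invmx (g i p) a k * nabla h i a k j p)).

Definition differential (f : M -> R) : covector_field := fun i p =>
  \row_j pd i j f p.

Definition delta_minus (h : tensor_field) : covector_field := fun i p =>
  delta h i p + differential (trg h) i p.

Definition inner_minus (h k : tensor_field) (p : M) : R :=
  \tr (invmx (g (chart_at p) p) *m h (chart_at p) p *m
       invmx (g (chart_at p) p) *m k (chart_at p) p)
  - trg h p * trg k p.

(* The quadratic map h |-> Gamma^-_g(h, h). *)
Definition Gamma_minus (h : tensor_field) : tensor_field := fun i p =>
  h i p *m invmx (g i p) *m h i p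
  - (2^-1 * trg h p) *: h i p
  - ((4 * (n%:R - 1))^-1 * inner_minus h h p) *: g i p.

Definition grad_minus_S (lambda : R) : tensor_field := fun i p =>
  - ricci i p
  + ((2 * (n%:R - 1))^-1 * scalar_curvature p) *: g i p
  + (lambda / 2) *: g i p.

Definition tau_lambda (lambda : R) (p : M) : R :=
  scalar_curvature p - lambda * (n%:R - 1).

Definition Hamiltonian (alpha lambda : R) (k : tensor_field) (p : M) : R :=
  2^-1 * inner_minus k k p + 2 * alpha * tau_lambda lambda p.

End Geometry.

Definition time_deriv (g : R -> tensor_field) : R -> tensor_field :=
  fun t i p => \matrix_(a, b) (fun s => g s i p a b)^`() t.

Definition momentum_constraint (g : R -> tensor_field) (t : R) : Prop :=
  eq_field (delta_minus (g t) (time_deriv g t)) (fun _ _ => 0).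

Definition evolution_equation (alpha lambda : R) (g : R -> tensor_field)
    (t : R) : Prop :=
  eq_field (time_deriv (time_deriv g) t)
    (fun i p => Gamma_minus (g t) (time_deriv g t) i p
                - (2 * alpha) *: grad_minus_S (g t) lambda i p).

Definition Hamiltonian_constraint (alpha lambda : R) (g : R -> tensor_field)
    (t : R) : Prop :=
  forall p, Hamiltonian (g t) alpha lambda (time_deriv g t) p = 0.

End Fields.

Arguments tensor_field {R n} M.
Arguments covector_field {R n} M.

(* Main.v *)
(* Scaling a metric by a constant leaves its Levi-Civita connection, hence its
   Ricci tensor, unchanged.  As the metric is parallel, every constant multiple
   of it is divergence free and has constant trace, whence (a); and with
   h = c' g0 all terms of the evolution equation and of the Hamiltonian
   constraint at c g0 are multiples of g0 and of 1 respectively, so that both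
   reduce to the comparison of one coefficient. *)
Require Import Defs.
From HB Require Import structures.
From mathcomp Require Import all_boot all_order all_algebra.
From mathcomp Require Import all_classical all_reals all_analysis.
From mathcomp Require Import ring.

Import Order.TTheory GRing.Theory Num.Theory.
Import numFieldNormedType.Exports.

Local Open Scope ring_scope.
Local Open Scope classical_set_scope.

(** * Coordinate derivatives and nondegeneracy of a metric *)

Section ScaledMetric.
Context {R : realType} {n : nat} {M : smoothManifold R n}.
Implicit Types (i : chart M) (p : M) (g h : tensor_field M) (c k : R).

(** The image of a chart is open, so a derivative at one of its points sees only values on the chart
    domain. Identities between fields, which hold only there, may thus be differentiated. *)
Lemma pd_eq_dom i a (f1 f2 : M -> R) p : dom i p ->
  (forall q, dom i q -> f1 q = f2 q) -> pd i a f1 p = pd i a f2 p.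
Proof.
move=> ip f12; apply: near_eq_derive.
have : open_nbhs (Defs.coord i p) (Defs.coord i @` dom i).
  by split; [exact: codom_open | exists p].
move/open_nbhs_nbhs; apply: filterS => _ [q iq <-] /=.
by rewrite coordK//; exact: f12.
Qed.

Lemma pd_cst i a k p : pd i a (fun=> k) p = 0.
Proof. exact: derive_cst. Qed.

Lemma pd_scale {g} : sym_tensor g -> forall i a k x y p, dom i p ->
  pd i a (fun q => (k *: g i q) x y) p = k * pd i a (fun q => g i q x y) p.
Proof.
move=> [_ _ gC] i a k x y p ip.
have [_ /(_ a)[gD _]] := gC i x y 1%N.
rewrite /pd (_ : _ \o _ = k \*: ((fun q => g i q x y) \o param i)).
  by apply: deriveZ; apply: gD; exists p.
by apply/funext => z /=; rewrite mxE.
Qed.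

Lemma pd_sym {g} : sym_tensor g -> forall i a x y p, dom i p ->
  pd i a (fun q => g i q x y) p = pd i a (fun q => g i q y x) p.
Proof.
move=> [gT _ _] i a x y p ip; apply: pd_eq_dom => // q iq.
by rewrite -[in RHS](gT i q iq) mxE.
Qed.

(** A nonzero [v] in the left kernel would give [v g v^T = 0], against positive definiteness. *)
Lemma metric_unitmx {g} : riemannian_metric g -> forall i p, dom i p ->
  g i p \in unitmx.
Proof.
move=> [_ gP] i p ip; rewrite -row_free_unit; apply: inj_row_free => v vg0.
apply/eqP/negPn/negP => /(gP i p ip).
by rewrite vg0 mul0mx mxE ltxx.
Qed.

Lemma metric_neq0 {g} : riemannian_metric g -> forall i p, (0 < n)%N ->
  dom i p -> g i p != 0.
Proof.
move=> gM i p n0 ip; apply/eqP => g0.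
have := mulmxV (metric_unitmx gM i p ip); rewrite g0 mul0mx.
move/(congr1 mxtrace); rewrite mxtrace0 mxtrace1 => /esym/eqP.
by rewrite pnatr_eq0 gtn_eqF.
Qed.

(** * Connection, curvature and traces under constant scaling *)

Lemma invmx_scale {g} : riemannian_metric g -> forall k i p, k != 0 ->
  dom i p -> invmx (k *: g i p) = k^-1 *: invmx (g i p).
Proof.
move=> gM k i p k0 ip; apply: invmxZ.
by rewrite unitmxZ ?unitfE// metric_unitmx.
Qed.

Lemma christoffel_scale {g} : riemannian_metric g -> forall k i l a b p,
  k != 0 -> dom i p ->
  christoffel (scale_field (fun=> k) g) i l a b p = christoffel g i l a b p.
Proof.
move=> gM k i l a b p k0 ip; rewrite /christoffel; congr (_ * _).
have gS := metric_sym_tensor gM.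
apply: eq_bigr => m _; rewrite /scale_field invmx_scale// !pd_scale//.
(* The factor [k^-1] of the inverse metric cancels the factor [k] of the three derivatives. *)
by rewrite mxE -mulrDr -mulrBr mulrACA mulVf// mul1r.
Qed.

(** Ricci is built from the Christoffel symbols and their first derivatives alone. *)
Lemma ricci_scale {g} : riemannian_metric g -> forall k i p, k != 0 ->
  dom i p -> ricci (scale_field (fun=> k) g) i p = ricci g i p.
Proof.
move=> gM k i p k0 ip; apply/matrixP => b d; rewrite mxE [RHS]mxE.
apply: eq_bigr => a _; apply: (congr2 +%R).
  apply: (congr2 (fun x y => x - y)).
  - apply: pd_eq_dom => [|q iq]; first exact: ip.
    exact: christoffel_scale.
  - apply: pd_eq_dom => [|q iq]; first exact: ip.
    exact: christoffel_scale.
by apply: eq_bigr => m _; rewrite !christoffel_scale.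
Qed.

Lemma trg_scalel {g} : riemannian_metric g -> forall k h p, k != 0 ->
  trg (scale_field (fun=> k) g) h p = k^-1 * trg g h p.
Proof.
move=> gM k h p k0; rewrite /trg invmx_scale//; last exact: chart_atP.
by rewrite -scalemxAl mxtraceZ.
Qed.

Lemma trg_scale {g} : riemannian_metric g -> forall c k p, c != 0 ->
  trg (scale_field (fun=> c) g) (scale_field (fun=> k) g) p = k / c * n%:R.
Proof.
move=> gM c k p c0; rewrite trg_scalel// /trg /scale_field.
rewrite -scalemxAr mulVmx ?mxtraceZ ?mxtrace1; first by rewrite mulrA (mulrC k).
by apply: metric_unitmx => //; exact: chart_atP.
Qed.

Lemma scalar_curvature_scale {g} : riemannian_metric g -> forall k p, k != 0 ->
  scalar_curvature (scale_field (fun=> k) g) p = k^-1 * scalar_curvature g p.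
Proof.
move=> gM k p k0; rewrite /scalar_curvature (trg_scalel gM _ _ _ k0) /trg.
by rewrite (ricci_scale gM _ _ _ k0 (chart_atP p)).
Qed.

Lemma inner_minus_scale {g} : riemannian_metric g -> forall c k p, c != 0 ->
  inner_minus (scale_field (fun=> c) g) (scale_field (fun=> k) g)
    (scale_field (fun=> k) g) p = (k / c) ^+ 2 * (n%:R - n%:R ^+ 2).
Proof.
move=> gM c k p c0; rewrite /inner_minus !trg_scale// /scale_field.
have ip := chart_atP p; have gU := metric_unitmx gM _ _ ip.
rewrite invmx_scale// -!(scalemxAl, scalemxAr) mulVmx// mul1mx.
rewrite mulVmx// !mxtraceZ mxtrace1.
by ring.
Qed.

(** Lowering the upper index cancels the inverse metric and leaves the Christoffel symbols of the
    first kind. *)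
Lemma sum_christoffel_lower {g} : riemannian_metric g -> forall i a b d p,
  dom i p ->
  \sum_l christoffel g i l a b p * g i p l d =
  2^-1 * (pd i a (fun q => g i q d b) p + pd i b (fun q => g i q d a) p
          - pd i d (fun q => g i q a b) p).
Proof.
move=> gM i a b d p ip.
pose F m := pd i a (fun q => g i q m b) p + pd i b (fun q => g i q m a) p
            - pd i m (fun q => g i q a b) p.
have gT := sym_tensor_sym (metric_sym_tensor gM) ip.
(* The sum is entry [d] of [g g^-1] applied to the column of brackets; symmetry of [g] brings its
   indices into the order of a matrix product. *)
transitivity (2^-1 * ((g i p *m invmx (g i p)) *m \col_m F m) d 0); last first.
  by rewrite mulmxV ?metric_unitmx// mul1mx mxE.
rewrite -mulmxA mxE mulr_sumr; apply: eq_bigr => l _.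
rewrite /christoffel mxE -{3}gT [in RHS]mxE -mulrA; congr (_ * _).
rewrite mulrC; congr (_ * _); apply: eq_bigr => m _.
by rewrite [in RHS]mxE.
Qed.

(** Metric compatibility: in the two first-kind symbols the derivatives along [b] and [d] cancel,
    and those along [a] add up to the derivative of the metric component. *)
Lemma nabla_metric {g} : riemannian_metric g -> forall i a b d p,
  dom i p -> nabla g g i a b d p = 0.
Proof.
move=> gM i a b d p ip; have gS := metric_sym_tensor gM.
have gT := sym_tensor_sym gS ip.
rewrite /nabla sum_christoffel_lower//.
under [X in _ - X]eq_bigr => l _ do rewrite -[g i p]gT mxE.
rewrite sum_christoffel_lower//.
rewrite (pd_sym gS i a d b)// (pd_sym gS i b d a)// (pd_sym gS i d b a)//.
by field.
Qed.

Lemma nabla_scale {g} : riemannian_metric g -> forall c k i a b d p, c != 0 ->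
  dom i p ->
  nabla (scale_field (fun=> c) g) (scale_field (fun=> k) g) i a b d p = 0.
Proof.
move=> gM c k i a b d p c0 ip.
(* Writing 0 as [k] times the vanishing derivative of [g] allows a term-by-term comparison. *)
rewrite -(mulr0 k) -(nabla_metric gM i a b d p ip) /nabla.
rewrite /scale_field pd_scale//; last exact: metric_sym_tensor.
rewrite !mulrBr !mulr_sumr; congr (_ - _ - _); apply: eq_bigr => l _.
- by rewrite christoffel_scale// mxE mulrCA.
- by rewrite christoffel_scale// mxE mulrCA.
Qed.

(** * Momentum constraint and right-hand side of the evolution equation *)

Lemma delta_minus_scale {g} : riemannian_metric g -> forall c k i p, c != 0 ->
  dom i p ->
  delta_minus (scale_field (fun=> c) g) (scale_field (fun=> k) g) i p = 0.
Proof.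
move=> gM c k i p c0 ip; apply/rowP => j; rewrite !mxE.
rewrite big1 => [|a _]; last first.
  by rewrite big1// => b _; rewrite nabla_scale ?mulr0.
rewrite (_ : trg _ _ = fun=> k / c * n%:R) ?pd_cst ?oppr0 ?addr0//.
by apply/funext => q; exact: trg_scale.
Qed.

Lemma Gamma_minus_scale {g} : riemannian_metric g -> forall c k i p,
  (2 <= n)%N -> c != 0 -> dom i p ->
  Gamma_minus (scale_field (fun=> c) g) (scale_field (fun=> k) g) i p =
  ((4 - n%:R) / 4 * (k ^+ 2 / c)) *: g i p.
Proof.
move=> gM c k i p n2 c0 ip; have gU := metric_unitmx gM _ _ ip.
rewrite /Gamma_minus inner_minus_scale// trg_scale// /scale_field.
rewrite invmx_scale// -!(scalemxAl, scalemxAr) mulmxV// mul1mx !scalerA.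
rewrite -!scalerBl; congr (_ *: _).
have n1 : n%:R - 1 != 0 :> R by rewrite subr_eq0 pnatr_eq1 gtn_eqF.
(* The coefficient of [k^2 / c] is [1 - n/2 - (n - n^2)/(4(n - 1)) = 1 - n/4]. *)
by field; rewrite c0.
Qed.

Lemma grad_minus_S_scale {g} : riemannian_metric g -> forall c e tau lambda i p,
  (2 <= n)%N -> c != 0 -> dom i p -> ricci g i p = e *: g i p ->
  scalar_curvature g p = tau ->
  grad_minus_S (scale_field (fun=> c) g) lambda i p =
  (- e + tau / (2 * (n%:R - 1)) + lambda / 2 * c) *: g i p.
Proof.
move=> gM c e tau lambda i p n2 c0 ip gE gtau.
rewrite /grad_minus_S ricci_scale// scalar_curvature_scale// gE gtau.
rewrite /scale_field !scalerA -scaleNr -!scalerDl; congr (_ *: _).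
have n1 : n%:R - 1 != 0 :> R by rewrite subr_eq0 pnatr_eq1 gtn_eqF.
by field; rewrite n1 c0.
Qed.

(** * Time derivatives and the reduction to scalar equations *)

Lemma time_deriv_scale (f : R -> R) h t : derivable f t 1 ->
  time_deriv (fun s => scale_field (fun=> f s) h) t =
  scale_field (fun=> derive1 f t) h.
Proof.
move=> fD; apply/funext => i; apply/funext => p; apply/matrixP => a b.
rewrite /time_deriv /scale_field !mxE.
by under eq_fun do rewrite mxE; exact: derive1Mr.
Qed.

(** Needed for the second derivative: the formula for the first one is available only for times in
    the open set [I]. *)
Lemma near_eq_time_deriv (g1 g2 : R -> tensor_field M) t :
  (\forall s \near t, g1 s = g2 s) -> time_deriv g1 t = time_deriv g2 t.
Proof.
move=> g12; apply/funext => i; apply/funext => p; apply/matrixP => a b.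
rewrite /time_deriv !mxE !derive1E; apply: near_eq_derive.
by apply: filterS g12 => s ->.
Qed.

End ScaledMetric.

Theorem proposition7p1 (R : realType) (n : nat) (n_ge2 : (2 <= n)%N)
    (M : smoothManifold R n)
    (M_compact : compact [set: M]) (M_connected : connected [set: M])
    (M_nonempty : [set: M] !=set0)
    (I : set R) (I_open : open I) (I_interval : is_interval I)
    (alpha lambda : R) (alpha_neq0 : alpha != 0)
    (g0 : tensor_field M) (g0_metric : riemannian_metric g0)
    (tau0 : R) (tau0E : forall p : M, scalar_curvature g0 p = tau0)
    (g0_einstein :
       eq_field (ricci g0) (scale_field (fun=> tau0 / n%:R) g0))
    (c : R -> R) (c_smooth : smooth1_on I c)
    (c_gt0 : forall t, I t -> 0 < c t) :
  let g : R -> tensor_field M := fun t => scale_field (fun=> c t) g0 in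
  let A := 4 * alpha * tau0 / (n%:R * (n%:R - 1)) in
  let B := 4 * alpha * lambda / n%:R in
  let scalar_evolution (t : R) :=
    derive1n 2 c t = (4 - n%:R) / 4 * (derive1 c t ^+ 2 / c t)
               + alpha * (n%:R - 2) * tau0 / (n%:R * (n%:R - 1))
               - alpha * lambda * c t in
  let scalar_constraint (t : R) :=
    derive1 c t ^+ 2 = A * c t - B * c t ^+ 2 in
  [/\ forall t, I t -> momentum_constraint g t,
      forall t, I t ->
        (evolution_equation alpha lambda g t <-> scalar_evolution t),
      forall t, I t ->
        (Hamiltonian_constraint alpha lambda g t <-> scalar_constraint t)
    & forall t, I t -> scalar_constraint t ->
        (scalar_evolution t <-> derive1n 2 c t = 2^-1 * A - B * c t)].
Proof.
move=> g A B scalar_evolution scalar_constraint.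
have c_neq0 t : I t -> c t != 0 by move=> /c_gt0; exact: lt0r_neq0.
have n0 : n%:R != 0 :> R by rewrite pnatr_eq0 -lt0n ltnW.
have n1 : n%:R - 1 != 0 :> R by rewrite subr_eq0 pnatr_eq1 gtn_eqF.
have g'E t : I t -> time_deriv g t = scale_field (fun=> derive1 c t) g0.
  by move=> It; apply: time_deriv_scale; exact: (c_smooth 0%N).
have g''E t : I t ->
    time_deriv (time_deriv g) t = scale_field (fun=> derive1n 2 c t) g0.
  move=> It.
  rewrite (@near_eq_time_deriv _ _ _ _
             (fun s => scale_field (fun=> derive1 c s) g0)).
    by apply: time_deriv_scale; exact: (c_smooth 1%N).
  have : nbhs t I by exact: open_nbhs_nbhs.
  by apply: filterS => s; exact: g'E.
(* A point where [g0] is nonzero lets coefficients of [g0] be compared in the forward direction of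
   (b). *)
have [p0 _] := M_nonempty; have ip0 := chart_atP p0.
have g0_neq0 : g0 (chart_at p0) p0 != 0.
  by apply: metric_neq0 => //; exact: ltnW.
split=> t It; have ct0 := c_neq0 t It.
- by move=> i p ip; rewrite g'E//; exact: delta_minus_scale.
- have rhsE i p : dom i p ->
      Gamma_minus (g t) (time_deriv g t) i p
        - (2 * alpha) *: grad_minus_S (g t) lambda i p =
      ((4 - n%:R) / 4 * (derive1 c t ^+ 2 / c t)
        + alpha * (n%:R - 2) * tau0 / (n%:R * (n%:R - 1))
        - alpha * lambda * c t) *: g0 i p.
    move=> ip; rewrite g'E// Gamma_minus_scale//.
    rewrite (grad_minus_S_scale g0_metric _ (tau0 / n%:R) tau0)//; last first.
      exact: g0_einstein.
    rewrite scalerA -scalerBl; congr (_ *: _).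
    (* The [tau0] terms combine through [1/n - 1/(2(n - 1)) = (n - 2)/(2n(n - 1))]. *)
    by field; rewrite ct0 n0 n1.
  rewrite /evolution_equation g''E//; split=> [|ev i p ip]; last first.
    by rewrite rhsE// -ev.
  move/(_ _ p0 ip0); rewrite rhsE// => /eqP.
  rewrite -subr_eq0 -scalerBl scaler_eq0 subr_eq0 (negPf g0_neq0) orbF.
  by move/eqP.
(* The Hamiltonian is the defect of the first order relation times a factor that vanishes nowhere,
   since [n >= 2] and [c t] is nonzero. *)
- have HE p : Hamiltonian (g t) alpha lambda (time_deriv g t) p =
      - (n%:R * (n%:R - 1) / (2 * c t ^+ 2)) *
      (derive1 c t ^+ 2 - (A * c t - B * c t ^+ 2)).
    rewrite /Hamiltonian /tau_lambda g'E// inner_minus_scale//.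
    rewrite scalar_curvature_scale// tau0E /A /B.
    by field; rewrite ct0 n0 n1.
  split=> [/(_ p0)|sc p]; last by rewrite HE sc subrr mulr0.
  have K0 : n%:R * (n%:R - 1) / (2 * c t ^+ 2) != 0.
    apply: mulf_neq0; first exact: mulf_neq0.
    by rewrite invr_eq0 mulf_eq0 expf_eq0 pnatr_eq0 (negPf ct0).
  by rewrite HE => /eqP; rewrite mulf_eq0 oppr_eq0 (negPf K0) subr_eq0 => /eqP.
- rewrite /scalar_evolution => ->.
  (* On the constraint set [c'^2 / c = A - B c], while the other two terms are [(n - 2) A / 4] and
     [- n B c / 4]; the dependence on [n] cancels in the sum, so both equations coincide. *)
  rewrite (_ : _ - alpha * lambda * c t = 2^-1 * A - B * c t)//.
  by rewrite /A /B; field; rewrite ct0 n0 n1.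
Qed.
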